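(* Let $m>n\ge1$ be integers. Then, for every $\delta\neq0$, the nonlinear mode $\Theta_m$ with initial values $\Theta_m(0)=\delta$, $\dot\Theta_m(0)=0$ is linearly stable with respect to the $n$-th mode $\Theta_n$.
   Context: For an integer $m\ge1$ the nonlinear mode $\Theta_m$ with initial value $\delta$ is the solution of $$\ddot{\Theta}_m(t)+m^4\Theta_m(t)+m^4\Theta_m(t)^3=0,\qquad \Theta_m(0)=\delta,\ \dot\Theta_m(0)=0 .$$ (It gives the solution $u(x,t)=\Theta_m(t)\sin(mx)$ of the beam equation $u_{tt}+u_{xxxx}-\frac{2}{\pi}\|u_x\|^2_{L^2(0,\pi)}u_{xx}=0$ on $(0,\pi)$ with $u=u_{xx}=0$ at $x=0,\pi$.) For integers $m,n\ge1$, $m\ne n$, the mode $\Theta_m$ is said to be linearly stable (unstable) with respect to the $n$-th mode $\Theta_n$ if $\xi\equiv0$ is a stable (unstable) solution of the linear Hill equation $$\ddot{\xi}(t)+\big(n^4+m^2n^2\Theta_m(t)^2\big)\xi(t)=0 ,$$ where stable means that all solutions $\xi$ of this equation are bounded on $\mathbb{R}$, and unstable means not stable. *)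

(* Defs.v *)
(* Stdlib reals with Coquelicot. *)
From Stdlib Require Import Reals.
From Coquelicot Require Import Coquelicot.
Open Scope R_scope.

(* Both clauses are needed: [ex_derive_n y 2 t] only says that the total
   function [Derive y] is differentiable at [t], not that [y] itself is. *)
Definition twice_derivable (y : R -> R) : Prop :=
  forall t : R, ex_derive_n y 1 t /\ ex_derive_n y 2 t.

Definition is_nonlinear_mode (m : nat) (delta : R) (Theta : R -> R) : Prop :=
  twice_derivable Theta /\
  (forall t : R,
     Derive_n Theta 2 t + INR m ^ 4 * Theta t + INR m ^ 4 * Theta t ^ 3 = 0) /\
  Theta 0 = delta /\
  Derive Theta 0 = 0.

Definition is_hill_solution (a xi : R -> R) : Prop :=
  twice_derivable xi /\
  (forall t : R, Derive_n xi 2 t + a t * xi t = 0).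

Definition bounded_on_R (xi : R -> R) : Prop :=
  exists M : R, forall t : R, Rabs (xi t) <= M.

Definition hill_stable (a : R -> R) : Prop :=
  forall xi : R -> R, is_hill_solution a xi -> bounded_on_R xi.

(* Here [Theta] stands for the [m]-th mode; of the [n]-th mode only the index
   enters the linearized equation. *)
Definition linearly_stable (m n : nat) (Theta : R -> R) : Prop :=
  hill_stable (fun t => INR n ^ 4 + INR m ^ 2 * INR n ^ 2 * Theta t ^ 2).

(* Main.v *)
(** Let [a] be the first zero of [Theta], so that the Hill potential
    [q = n^4 + m^2 n^2 Theta^2] is even, symmetric about [a] and [2a]-periodic.
    Since [n < m], [q] is smaller than the potentials [m^4 (1 + Theta^2)] and
    [m^4 (1 + 3 Theta^2)], whose equations are solved by [Theta] (a "cosine" on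
    [[0, a]]) and by [- Theta'] (a "sine" on [[0, a]]). For an even solution [u],
    [u (t + 2a) + u (t - 2a) = 2 k u t] with [k = u (2a) / u 0]; comparing [u] on
    [[0, a]], and then [u (a + s) + u (a - s)] and [u (a - s) - u (a + s)], with
    these two functions gives [|k| < 1], hence boundedness. Odd solutions are
    treated in the same way with [k = v' (2a) / v' 0]. *)
Require Import Defs.
From Stdlib Require Import ZArith Reals Lra Lia Classical.
From Coquelicot Require Import Coquelicot.
Open Scope R_scope.

(** * Calculus preliminaries: monotonicity, reflections, translates and first zeros *)

Lemma lt_of_derive_pos (f df : R -> R) (a b : R) :
  a < b -> (forall t, is_derive f t (df t)) ->
  (forall t, a < t < b -> 0 < df t) -> f a < f b.
Proof.
intros Hab Hf Hpos.
destruct (MVT_cor2 f df a b Hab) as [c [Hc Hin]].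
{ intros c _. apply is_derive_Reals, Hf. }
specialize (Hpos c Hin). nra.
Qed.

Lemma le_of_derive_nonpos (f df : R -> R) (a b : R) :
  a <= b -> (forall t, is_derive f t (df t)) ->
  (forall t, a < t < b -> df t <= 0) -> f b <= f a.
Proof.
intros Hab Hf Hneg.
destruct (Req_dec a b) as [->|Hne]; [lra|].
destruct (MVT_cor2 f df a b) as [c [Hc Hin]]; [lra| |].
{ intros c _. apply is_derive_Reals, Hf. }
specialize (Hneg c Hin). nra.
Qed.

Lemma is_derive_continuity (f df : R -> R) :
  (forall t, is_derive f t (df t)) -> continuity f.
Proof.
intros Hf t. apply derivable_continuous_pt.
exists (df t). apply is_derive_Reals, Hf.
Qed.

Lemma is_derive_reflect (f df : R -> R) (c t : R) :
  (forall x, is_derive f x (df x)) ->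
  is_derive (fun x => f (c - x)) t (- df (c - t)).
Proof.
intros Hf. auto_derive.
- eexists; apply Hf.
- rewrite (is_derive_unique (fun x => f x) _ _ (Hf _)). unfold Rminus. ring.
Qed.

Lemma is_derive_shift (f df : R -> R) (c t : R) :
  (forall x, is_derive f x (df x)) ->
  is_derive (fun x => f (x + c)) t (df (t + c)).
Proof.
intros Hf. auto_derive.
- eexists; apply Hf.
- rewrite (is_derive_unique (fun x => f x) _ _ (Hf _)). ring.
Qed.

Lemma is_derive_lin_comb (f df g dg : R -> R) (a b t : R) :
  (forall x, is_derive f x (df x)) -> (forall x, is_derive g x (dg x)) ->
  is_derive (fun x => a * f x + b * g x) t (a * df t + b * dg t).
Proof.
intros Hf Hg. auto_derive.
- split; [eexists; apply Hf | split; [eexists; apply Hg | easy]].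
- rewrite (is_derive_unique (fun x => f x) _ _ (Hf _)),
    (is_derive_unique (fun x => g x) _ _ (Hg _)). ring.
Qed.

Lemma first_zero (z : R -> R) (e b : R) :
  continuity z -> 0 < e -> (forall t, 0 < t < e -> 0 < z t) ->
  0 < b -> z b <= 0 ->
  exists t1, 0 < t1 <= b /\ z t1 = 0 /\ (forall t, 0 < t < t1 -> 0 < z t).
Proof.
intros Hz He Hpos Hb Hzb.
set (E := fun t => 0 < t <= b /\ forall s, 0 < s < t -> 0 < z s).
assert (Heb : e <= b).
{ apply Rnot_lt_le. intros H. specialize (Hpos b). lra. }
destruct (completeness E) as [l [Hub Hlub]].
- exists b. intros t [Ht _]. lra.
- exists e. split; [lra | exact Hpos].
- assert (Hel : e <= l) by (apply Hub; split; [lra | exact Hpos]).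
  assert (Hlb : l <= b) by (apply Hlub; intros t [Ht _]; lra).
  assert (Hbelow : forall t, 0 < t < l -> 0 < z t).
  { intros t Ht. apply Rnot_le_lt. intros Hzt.
    assert (l <= t); [|lra].
    apply Hlub. intros s [Hs Hs']. apply Rnot_lt_le. intros Hts.
    specialize (Hs' t). lra. }
  exists l. split; [lra|]. split; [|exact Hbelow].
  destruct (Rtotal_order (z l) 0) as [Hneg|[H0|Hp]]; [| exact H0 |].
  + destruct (Hz l (- z l)) as [d [Hd Hcont]]; [lra|].
    set (s := l - Rmin (d / 2) (l / 2)).
    assert (Hs : 0 < s < l /\ l - s < d).
    { unfold s. pose proof (Rmin_l (d / 2) (l / 2)).
      pose proof (Rmin_r (d / 2) (l / 2)).
      pose proof (Rmin_pos (d / 2) (l / 2)). lra. }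
    specialize (Hcont s). simpl in Hcont. unfold R_dist in Hcont.
    assert (Hc : Rabs (z s - z l) < - z l).
    { apply Hcont. split; [split; [exact I | lra] |].
      apply Rabs_def1; lra. }
    apply Rabs_def2 in Hc. specialize (Hbelow s). lra.
  + destruct (Rle_lt_or_eq_dec _ _ Hlb) as [Hlt| ->]; [|lra].
    destruct (Hz l (z l)) as [d [Hd Hcont]]; [lra|].
    set (s := l + Rmin (d / 2) (b - l)).
    assert (Hs : l < s <= b /\ s - l < d).
    { unfold s. pose proof (Rmin_l (d / 2) (b - l)).
      pose proof (Rmin_r (d / 2) (b - l)).
      pose proof (Rmin_pos (d / 2) (b - l)). lra. }
    assert (s <= l); [|lra].
    apply Hub. split; [lra|]. intros t Ht.
    destruct (Rtotal_order t l) as [H|[->|H]]; [apply Hbelow; lra | lra |].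
    specialize (Hcont t). simpl in Hcont. unfold R_dist in Hcont.
    assert (Hc : Rabs (z t - z l) < z l).
    { apply Hcont. split; [split; [exact I | lra] |].
      apply Rabs_def1; lra. }
    apply Rabs_def2 in Hc. lra.
Qed.

(** * Hill equations: symmetries and uniqueness *)

(** The derivative is carried as explicit data, so that reflections and translates act on the pair
    [(y, dy)]. *)
Definition hill (q y dy : R -> R) : Prop :=
  (forall t, is_derive y t (dy t)) /\ (forall t, is_derive dy t (- q t * y t)).

Lemma hill_reflect (q y dy : R -> R) (c : R) :
  hill q y dy ->
  hill (fun t => q (c - t)) (fun t => y (c - t)) (fun t => - dy (c - t)).
Proof.
intros [Hy Hdy]. split; intros t.
- now apply is_derive_reflect.
- replace (- q (c - t) * y (c - t)) with (- (- (- q (c - t) * y (c - t)))) by ring.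
  apply (is_derive_opp (fun x => dy (c - x))).
  now apply (is_derive_reflect dy (fun x => - q x * y x)).
Qed.

Lemma hill_shift (q y dy : R -> R) (c : R) :
  hill q y dy ->
  hill (fun t => q (t + c)) (fun t => y (t + c)) (fun t => dy (t + c)).
Proof.
intros [Hy Hdy]. split; intros t.
- now apply is_derive_shift.
- now apply (is_derive_shift dy (fun x => - q x * y x)).
Qed.

Lemma hill_ext (q p y dy : R -> R) :
  (forall t, q t = p t) -> hill q y dy -> hill p y dy.
Proof.
intros Hq [H1 H2]. split; intros t; [apply H1|]. rewrite <- Hq. apply H2.
Qed.

Lemma hill_lin_comb (q y dy z dz : R -> R) (a b : R) :
  hill q y dy -> hill q z dz ->
  hill q (fun t => a * y t + b * z t) (fun t => a * dy t + b * dz t).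
Proof.
intros [H1 H2] [H3 H4]. split; intros t.
- apply is_derive_lin_comb; assumption.
- replace (- q t * (a * y t + b * z t))
    with (a * (- q t * y t) + b * (- q t * z t)) by ring.
  now apply (is_derive_lin_comb dy (fun x => - q x * y x) dz
               (fun x => - q x * z x)).
Qed.

(** A Gronwall argument: [y ^ 2 + dy ^ 2], damped by a fast enough exponential, is nonincreasing and
    starts at zero. *)
Lemma hill_zero_right (q y dy : R -> R) (t0 t : R) :
  continuity q -> hill q y dy -> y t0 = 0 -> dy t0 = 0 -> t0 <= t ->
  y t = 0 /\ dy t = 0.
Proof.
intros Hq [Hy Hdy] H0 H0' Ht.
destruct (continuity_ab_maj (fun x => Rabs (q x)) t0 t Ht) as [c [Hc _]].
{ intros x _. apply (continuity_pt_comp q Rabs); [apply Hq | apply Rcontinuity_abs]. }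
(* [Rabs (q x)] is maximal at [c] on [[t0, t]], so [K] bounds [Rabs (1 - q x)] there. *)
set (K := 1 + Rabs (q c)).
set (f := fun x => (y x ^ 2 + dy x ^ 2) * exp (- K * (x - t0))).
set (df := fun x => (2 * y x * dy x * (1 - q x) - K * (y x ^ 2 + dy x ^ 2))
                    * exp (- K * (x - t0))).
assert (Hf : f t <= f t0).
{ apply (le_of_derive_nonpos f df); [exact Ht | |].
  - intros x. unfold f, df. auto_derive.
    + split; [eexists; apply Hy | split; [eexists; apply Hdy | easy]].
    + rewrite (is_derive_unique (fun x => y x) _ _ (Hy _)),
        (is_derive_unique (fun x => dy x) _ _ (Hdy _)).
      unfold Rminus. ring.
  - intros x Hx. unfold df.
    assert (Hle : Rabs (q x) <= Rabs (q c)) by (apply Hc; lra).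
    assert (HK : Rabs (1 - q x) <= K).
    { unfold K. unfold Rabs in Hle |- *. destruct (Rcase_abs (1 - q x)),
        (Rcase_abs (q x)), (Rcase_abs (q c)); lra. }
    apply Rabs_le_between in HK.
    pose proof (exp_pos (- K * (x - t0))) as He.
    assert (2 * y x * dy x * (1 - q x) <= K * (y x ^ 2 + dy x ^ 2)); [|nra].
    (* This sum is twice the difference of the two sides of the inequality to be proved. *)
    assert (0 <= (K - (1 - q x)) * (y x + dy x) ^ 2
              + (K + (1 - q x)) * (y x - dy x) ^ 2); [|nra].
    apply Rplus_le_le_0_compat; apply Rmult_le_pos; try apply pow2_ge_0; lra. }
unfold f in Hf. rewrite H0, H0' in Hf.
pose proof (exp_pos (- K * (t - t0))) as He.
assert (y t ^ 2 + dy t ^ 2 <= 0) by nra.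
pose proof (pow2_ge_0 (y t)). pose proof (pow2_ge_0 (dy t)).
split; nra.
Qed.

Lemma hill_zero (q y dy : R -> R) (t0 : R) :
  continuity q -> hill q y dy -> y t0 = 0 -> dy t0 = 0 ->
  forall t, y t = 0 /\ dy t = 0.
Proof.
intros Hq Hh H0 H0' t. destruct (Rle_dec t0 t) as [Ht|Ht].
- now apply (hill_zero_right q y dy t0).
- destruct (hill_zero_right (fun x => q (0 - x)) (fun x => y (0 - x))
    (fun x => - dy (0 - x)) (- t0) (- t)) as [H1 H2].
  + apply (continuity_comp (fun x => 0 - x) q); [|exact Hq].
    apply (is_derive_continuity _ (fun _ => -1)). intros x. auto_derive; [easy | ring].
  + now apply hill_reflect.
  + replace (0 - - t0) with t0 by ring. lra.
  + replace (0 - - t0) with t0 by ring. lra.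
  + lra.
  + replace (0 - - t) with t in H1, H2 by ring. lra.
Qed.

Lemma hill_unique (q y dy z dz : R -> R) (t0 : R) :
  continuity q -> hill q y dy -> hill q z dz -> y t0 = z t0 -> dy t0 = dz t0 ->
  forall t, y t = z t /\ dy t = dz t.
Proof.
intros Hq Hy Hz H0 H0' t.
destruct (hill_zero q _ _ t0 Hq (hill_lin_comb q y dy z dz 1 (-1) Hy Hz)) with (t := t);
  lra.
Qed.

(** * Sturm comparison on a quarter period *)

(** The Wronskian [dz * y - z * dy] vanishes at [0] and has derivative [(Q - q) * y * z], so it is
    positive as long as [z] is. At a first zero of [z] this forces a positive slope, which is
    absurd. The Wronskian form of the initial condition covers cosine and sine data alike. *)
Lemma sturm_comparison (q Q y dy z dz : R -> R) (e a : R) :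
  hill Q y dy -> hill q z dz -> 0 < a ->
  (forall t, 0 < t < a -> q t < Q t) ->
  (forall t, 0 < t < a -> 0 < y t) -> 0 <= y a ->
  dz 0 * y 0 = z 0 * dy 0 ->
  0 < e -> (forall t, 0 < t < e -> 0 < z t) ->
  (forall t, 0 < t <= a -> 0 < z t) /\ z a * dy a < dz a * y a.
Proof.
intros [Hy Hdy] [Hz Hdz] Ha HqQ Hypos Hya HW0 He Hzpos.
set (W := fun t => dz t * y t - z t * dy t).
(* The endpoint [b] is left free: it will be a supposed first zero of [z], and then [a] itself. *)
assert (HW : forall b, 0 < b <= a -> (forall t, 0 < t < b -> 0 < z t) -> 0 < W b).
{ intros b Hb Hzb. replace 0 with (W 0) by (unfold W; lra).
  apply (lt_of_derive_pos W (fun t => (Q t - q t) * (y t * z t))); [lra | |].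
  - intros t. unfold W. auto_derive.
    + repeat match goal with |- _ /\ _ => split end; [eexists; apply Hdz
      | eexists; apply Hy | eexists; apply Hz | eexists; apply Hdy | easy].
    + rewrite (is_derive_unique (fun x => y x) _ _ (Hy _)),
        (is_derive_unique (fun x => dy x) _ _ (Hdy _)),
        (is_derive_unique (fun x => z x) _ _ (Hz _)),
        (is_derive_unique (fun x => dz x) _ _ (Hdz _)). ring.
  - intros t Ht. assert (q t < Q t) by (apply HqQ; lra).
    assert (0 < y t) by (apply Hypos; lra). specialize (Hzb t Ht).
    apply Rmult_lt_0_compat; [lra|]. now apply Rmult_lt_0_compat. }
assert (Hall : forall t, 0 < t <= a -> 0 < z t).
{ intros t Ht. apply Rnot_le_lt. intros Hzt.
  destruct (first_zero z e t) as [t1 [Ht1 [Hz1 Hbelow]]]; try assumption; try lra.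
  { now apply (is_derive_continuity z dz). }
  assert (HW1 : 0 < W t1) by (apply HW; [lra | exact Hbelow]).
  unfold W in HW1. rewrite Hz1 in HW1.
  assert (0 <= y t1).
  { destruct (Rle_lt_or_eq_dec t1 a) as [H| ->]; [lra | | exact Hya].
    apply Rlt_le, Hypos. lra. }
  assert (Hd : 0 < dz t1) by nra.
  (* a positive slope at the zero [t1] would make [z] negative just before it *)
  assert (Hlim := proj1 (is_derive_Reals _ _ _) (Hz t1)).
  destruct (Hlim (dz t1) Hd) as [d Hdelta].
  set (h := Rmin (d / 2) (t1 / 2)).
  assert (Hh : 0 < h /\ h < d /\ h < t1).
  { unfold h. pose proof (cond_pos d). pose proof (Rmin_l (d / 2) (t1 / 2)).
    pose proof (Rmin_r (d / 2) (t1 / 2)).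
    pose proof (Rmin_pos (d / 2) (t1 / 2)). lra. }
  assert (Habs : Rabs ((z (t1 + - h) - z t1) / - h - dz t1) < dz t1).
  { apply Hdelta; [lra|]. apply Rabs_def1; lra. }
  apply Rabs_def2 in Habs. rewrite Hz1 in Habs.
  assert (Hzh : 0 < z (t1 + - h)) by (apply Hbelow; lra).
  assert (0 < z (t1 + - h) / h) by (apply Rdiv_lt_0_compat; lra).
  replace ((z (t1 + - h) - 0) / - h) with (- (z (t1 + - h) / h)) in Habs
    by (field; lra).
  lra. }
split; [exact Hall|].
assert (HWa : 0 < W a) by (apply HW; [lra | intros t Ht; apply Hall; lra]).
unfold W in HWa. lra.
Qed.

Lemma pos_right_of_pos (z dz : R -> R) :
  (forall t, is_derive z t (dz t)) -> 0 < z 0 ->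
  exists e, 0 < e /\ forall t, 0 < t < e -> 0 < z t.
Proof.
intros Hz H0.
destruct (is_derive_continuity z dz Hz 0 (z 0) H0) as [d [Hd Hcont]].
exists d. split; [lra|]. intros t Ht.
specialize (Hcont t). simpl in Hcont. unfold R_dist in Hcont.
assert (Hc : Rabs (z t - z 0) < z 0).
{ apply Hcont. split; [split; [exact I | lra] |]. apply Rabs_def1; lra. }
apply Rabs_def2 in Hc. lra.
Qed.

Lemma pos_right_of_derive_pos (z dz ddz : R -> R) :
  (forall t, is_derive z t (dz t)) -> (forall t, is_derive dz t (ddz t)) ->
  z 0 = 0 -> 0 < dz 0 ->
  exists e, 0 < e /\ forall t, 0 < t < e -> 0 < z t.
Proof.
intros Hz Hdz H0 H0'.
destruct (pos_right_of_pos dz ddz Hdz H0') as [e [He Hpos]].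
exists e. split; [exact He|]. intros t Ht. rewrite <- H0.
apply (lt_of_derive_pos z dz); [lra | exact Hz |].
intros s Hs. apply Hpos. lra.
Qed.

(** Modelled on cosine, and below on sine, over [[0, PI / 2]]; the reflection [t -> a - t] exchanges
    the two notions. *)
Definition cos_like (q y dy : R -> R) (a : R) : Prop :=
  hill q y dy /\ dy 0 = 0 /\ y a = 0 /\ (forall t, 0 <= t < a -> 0 < y t).

Definition sin_like (q y dy : R -> R) (a : R) : Prop :=
  hill q y dy /\ y 0 = 0 /\ dy a = 0 /\ (forall t, 0 < t <= a -> 0 < y t).

Lemma cos_like_reflect (q y dy : R -> R) (a : R) :
  cos_like q y dy a ->
  sin_like (fun t => q (a - t)) (fun t => y (a - t)) (fun t => - dy (a - t)) a.
Proof.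
intros [Hh [H0 [Ha Hpos]]]. split; [now apply hill_reflect|]. split; [|split].
- now rewrite Rminus_0_r.
- rewrite Rminus_diag. lra.
- intros t Ht. apply Hpos. lra.
Qed.

Lemma sin_like_reflect (q y dy : R -> R) (a : R) :
  sin_like q y dy a ->
  cos_like (fun t => q (a - t)) (fun t => y (a - t)) (fun t => - dy (a - t)) a.
Proof.
intros [Hh [H0 [Ha Hpos]]]. split; [now apply hill_reflect|]. split; [|split].
- rewrite Rminus_0_r. lra.
- now rewrite Rminus_diag.
- intros t Ht. apply Hpos. lra.
Qed.

(** Once comparison makes [z] positive, [z] is strictly concave because [q] is positive, so its
    slope drops below [0]. *)
Lemma sturm_cos (q Q y dy z dz : R -> R) (a : R) :
  0 < a -> cos_like Q y dy a -> hill q z dz ->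
  (forall t, 0 < q t < Q t) -> 0 < z 0 -> dz 0 = 0 ->
  0 < z a /\ dz a < 0.
Proof.
intros Ha [Hy [Hy0 [Hya Hypos]]] Hz Hq Hz0 Hdz0.
destruct (pos_right_of_pos z dz (proj1 Hz) Hz0) as [e [He Hepos]].
destruct (sturm_comparison q Q y dy z dz e a) as [Hpos _]; try assumption.
- intros t _. apply Hq.
- intros t Ht. apply Hypos. lra.
- lra.
- rewrite Hy0, Hdz0. ring.
- split; [apply Hpos; lra|].
  assert (Hlt : - dz 0 < - dz a); [|lra].
  apply (lt_of_derive_pos (fun t => - dz t) (fun t => q t * z t)); [exact Ha | |].
  + intros t. replace (q t * z t) with (- (- q t * z t)) by ring.
    apply (is_derive_opp dz), (proj2 Hz).
  + intros t Ht. apply Rmult_lt_0_compat; [apply Hq | apply Hpos; lra].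
Qed.

(** At [a] the comparison function has zero slope, so positivity of the Wronskian there reduces to
    [0 < dz a * y a]. *)
Lemma sturm_sin (q Q y dy z dz : R -> R) (a : R) :
  0 < a -> sin_like Q y dy a -> hill q z dz ->
  (forall t, 0 < q t < Q t) -> z 0 = 0 -> 0 < dz 0 ->
  0 < z a /\ 0 < dz a.
Proof.
intros Ha [Hy [Hy0 [Hya Hypos]]] Hz Hq Hz0 Hdz0.
destruct (pos_right_of_derive_pos z dz _ (proj1 Hz) (proj2 Hz) Hz0 Hdz0)
  as [e [He Hepos]].
assert (Hay : 0 < y a) by (apply Hypos; lra).
destruct (sturm_comparison q Q y dy z dz e a) as [Hpos HW]; try assumption.
- intros t _. apply Hq.
- intros t Ht. apply Hypos. lra.
- lra.
- rewrite Hy0, Hz0. ring.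
- split; [apply Hpos; lra|]. rewrite Hya in HW. nra.
Qed.

(* Sums and differences of the two translates solve the equation centred at the
   symmetry point [a], so the comparison can be restarted there. *)
Lemma hill_center (q y dy : R -> R) (a r s : R) :
  (forall t, q (t + a) = q (a - t)) -> hill q y dy ->
  hill (fun t => q (a - t)) (fun t => r * y (t + a) + s * y (a - t))
    (fun t => r * dy (t + a) + s * - dy (a - t)).
Proof.
intros Hq Hy. apply (hill_lin_comb (fun t => q (a - t)) (fun t => y (t + a))
  (fun t => dy (t + a)) (fun t => y (a - t)) (fun t => - dy (a - t))).
- apply (hill_ext (fun t => q (t + a))); [exact Hq | now apply hill_shift].
- now apply hill_reflect.
Qed.

(** * Bounds on the multipliers over one period [2 * a] *)

Section Multipliers.

Variables (q Q1 Q2 C dC S dS : R -> R) (a : R).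
Hypothesis Ha : 0 < a.
Hypothesis Hqa : forall t, q (t + a) = q (a - t).
Hypothesis Hq1 : forall t, 0 < q t < Q1 t.
Hypothesis Hq2 : forall t, 0 < q t < Q2 t.
Hypothesis HC : cos_like Q1 C dC a.
Hypothesis HS : sin_like Q2 S dS a.

(** Comparison on [[0, a]] gives [u a > 0 > du a]. These are the data at [t = 0] that let
    [u (a + t) + u (a - t)] be compared with the reflected [S], and [u (a - t) - u (a + t)] with the
    reflected [C]. Their values at [t = a] are [u (2 * a) + u 0] and [u 0 - u (2 * a)]. *)
Lemma even_multiplier (u du : R -> R) :
  hill q u du -> 0 < u 0 -> du 0 = 0 -> - u 0 < u (2 * a) < u 0.
Proof.
intros Hu Hu0 Hdu0.
destruct (sturm_cos q Q1 C dC u du a) as [Hua Hdua]; try assumption.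
destruct (sturm_cos (fun t => q (a - t)) _ _ _ _ _ a Ha (sin_like_reflect _ _ _ _ HS)
            (hill_center q u du a 1 1 Hqa Hu)) as [Hp _].
{ intros t. apply Hq2. }
{ rewrite Rplus_0_l, Rminus_0_r. lra. }
{ rewrite Rplus_0_l, Rminus_0_r. ring. }
destruct (sturm_sin (fun t => q (a - t)) _ _ _ _ _ a Ha (cos_like_reflect _ _ _ _ HC)
            (hill_center q u du a (-1) 1 Hqa Hu)) as [Hm _].
{ intros t. apply Hq1. }
{ rewrite Rplus_0_l, Rminus_0_r. ring. }
{ rewrite Rplus_0_l, Rminus_0_r. lra. }
replace (a + a) with (2 * a) in Hp, Hm by ring. rewrite Rminus_diag in Hp, Hm. lra.
Qed.

(** As in the even case, but the slopes at [t = a] are read off: the sum of the translates has slope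
    [dv (2 * a) - dv 0 < 0], the difference has slope [dv (2 * a) + dv 0 > 0]. *)
Lemma odd_multiplier (v dv : R -> R) :
  hill q v dv -> v 0 = 0 -> 0 < dv 0 -> - dv 0 < dv (2 * a) < dv 0.
Proof.
intros Hv Hv0 Hdv0.
destruct (sturm_sin q Q2 S dS v dv a) as [Hva Hdva]; try assumption.
destruct (sturm_cos (fun t => q (a - t)) _ _ _ _ _ a Ha (sin_like_reflect _ _ _ _ HS)
            (hill_center q v dv a 1 1 Hqa Hv)) as [_ Hp].
{ intros t. apply Hq2. }
{ rewrite Rplus_0_l, Rminus_0_r. lra. }
{ rewrite Rplus_0_l, Rminus_0_r. ring. }
destruct (sturm_sin (fun t => q (a - t)) _ _ _ _ _ a Ha (cos_like_reflect _ _ _ _ HC)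
            (hill_center q v dv a 1 (-1) Hqa Hv)) as [_ Hm].
{ intros t. apply Hq1. }
{ rewrite Rplus_0_l, Rminus_0_r. ring. }
{ rewrite Rplus_0_l, Rminus_0_r. lra. }
replace (a + a) with (2 * a) in Hp, Hm by ring. rewrite Rminus_diag in Hp, Hm. lra.
Qed.

End Multipliers.

(** * Boundedness from a two-step recurrence *)

Lemma periodic_bounded_above (f : R -> R) (p : R) :
  0 < p -> continuity f -> (forall t, f (t + p) = f t) ->
  exists B, forall t, f t <= B.
Proof.
intros Hp Hf Hper.
assert (Hnat : forall (n : nat) t, f (t + INR n * p) = f t).
{ induction n as [|n IH]; intros t.
  - simpl. f_equal. ring.
  - rewrite S_INR, <- (IH t), <- (Hper (t + INR n * p)). f_equal. ring. }
assert (HZ : forall (z : Z) t, f (t + IZR z * p) = f t).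
{ intros z t. destruct (Z.le_ge_cases 0 z) as [Hz|Hz].
  - rewrite <- (Z2Nat.id z Hz), <- INR_IZR_INZ. apply Hnat.
  - rewrite <- (Hnat (Z.to_nat (- z)) (t + IZR z * p)).
    rewrite INR_IZR_INZ, Z2Nat.id, opp_IZR by lia. f_equal. ring. }
destruct (continuity_ab_maj f 0 p) as [c [Hc _]]; [lra | intros; apply Hf |].
exists (f c). intros t.
destruct (archimed (t / p)) as [H1 H2].
(* [up r - 1] is an integer [k] with [k <= r < k + 1], so this shift brings [t] into [[0, p]]. *)
rewrite <- (HZ (1 - up (t / p))%Z t). apply Hc. rewrite minus_IZR.
assert (Ht : t = t / p * p) by (field; lra).
split; rewrite Ht at 1; nra.
Qed.

(* [f (t + p) ^ 2 + f t ^ 2 - 2 k f t f (t + p)] is [p]-periodic, and positive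
   definite in [(f t, f (t + p))] because [|k| < 1]. *)
Lemma bounded_of_recurrence (f : R -> R) (p k : R) :
  0 < p -> continuity f -> -1 < k < 1 ->
  (forall t, f (t + p) + f (t - p) = 2 * k * f t) -> bounded_on_R f.
Proof.
intros Hp Hf Hk Hrec.
set (I := fun t => f (t + p) * f (t + p) + f t * f t - 2 * k * (f t * f (t + p))).
destruct (periodic_bounded_above I p Hp) as [B HB].
- assert (Hg : continuity (fun t => f (t + p))).
  { apply (continuity_comp (fun t => t + p) f); [|exact Hf].
    apply (is_derive_continuity _ (fun _ => 1)). intros t. auto_derive; [easy | ring]. }
  apply (continuity_minus (fun t => f (t + p) * f (t + p) + f t * f t)
           (fun t => 2 * k * (f t * f (t + p)))).
  + apply (continuity_plus (fun t => f (t + p) * f (t + p)) (fun t => f t * f t));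
      now apply continuity_mult.
  + apply (continuity_scal (fun t => f t * f (t + p))). now apply continuity_mult.
- intros t. unfold I. specialize (Hrec (t + p)).
  replace (t + p - p) with t in Hrec by ring.
  replace (f (t + p + p)) with (2 * k * f (t + p) - f t) by lra. ring.
(* The summand [1] passes from a bound on the square to one on the absolute value, by
   [Rabs r <= r ^ 2 + 1]. *)
- exists (B / (1 - k ^ 2) + 1). intros t.
  assert (Hk2 : 0 < 1 - k ^ 2) by nra.
  assert (Hsq : f t ^ 2 <= B / (1 - k ^ 2)).
  { apply -> Rle_div_r; [|exact Hk2]. specialize (HB t). unfold I in HB.
    (* Completing the square: this square equals [I t - (1 - k ^ 2) * f t ^ 2]. *)
    pose proof (pow2_ge_0 (f (t + p) - k * f t)). nra. }
  apply Rabs_le. split; nra.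
Qed.

(** * Boundedness of all solutions for a doubly symmetric potential *)

Section Boundedness.

Variables (q Q1 Q2 C dC S dS : R -> R) (a : R).
Hypothesis Ha : 0 < a.
Hypothesis Hcont : continuity q.
Hypothesis Hqeven : forall t, q (0 - t) = q t.
Hypothesis Hqa : forall t, q (t + a) = q (a - t).
Hypothesis Hq1 : forall t, 0 < q t < Q1 t.
Hypothesis Hq2 : forall t, 0 < q t < Q2 t.
Hypothesis HC : cos_like Q1 C dC a.
Hypothesis HS : sin_like Q2 S dS a.

Lemma hill_two_translates (y dy : R -> R) :
  hill q y dy ->
  hill q (fun t => 1 * y (t + 2 * a) + 1 * y (t + - (2 * a)))
    (fun t => 1 * dy (t + 2 * a) + 1 * dy (t + - (2 * a))).
Proof.
(* The reflections about [a] and about [0] compose to the translation by [2 * a]. *)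
assert (Hper : forall t, q (t + 2 * a) = q t).
{ intros t. replace (t + 2 * a) with ((t + a) + a) by ring.
  rewrite Hqa, <- Hqeven. f_equal. ring. }
intros Hy.
apply (hill_lin_comb q (fun t => y (t + 2 * a)) (fun t => dy (t + 2 * a))
         (fun t => y (t + - (2 * a))) (fun t => dy (t + - (2 * a)))).
- apply (hill_ext (fun t => q (t + 2 * a))); [exact Hper | now apply hill_shift].
- apply (hill_ext (fun t => q (t + - (2 * a)))); [|now apply hill_shift].
  intros t. rewrite <- Hper. f_equal. ring.
Qed.

Lemma hill_reflect_origin (y dy : R -> R) :
  hill q y dy -> hill q (fun t => y (0 - t)) (fun t => - dy (0 - t)).
Proof.
intros Hy. apply (hill_ext (fun t => q (0 - t))); [exact Hqeven | now apply hill_reflect].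
Qed.

(** The sum of the two translates and [2 * k * y] solve the same equation with the same data at [0],
    so the recurrence holds everywhere. *)
Lemma hill_bounded_of_multiplier (y dy : R -> R) (k : R) :
  hill q y dy -> -1 < k < 1 ->
  y (2 * a) + y (- (2 * a)) = 2 * k * y 0 ->
  dy (2 * a) + dy (- (2 * a)) = 2 * k * dy 0 ->
  bounded_on_R y.
Proof.
intros Hy Hk H0 H0'.
apply (bounded_of_recurrence y (2 * a) k); [lra | | exact Hk |].
- apply (is_derive_continuity y dy), Hy.
- intros t.
  destruct (hill_unique q _ _ _ _ 0 Hcont (hill_two_translates y dy Hy)
              (hill_lin_comb q _ _ _ _ (2 * k) 0 Hy Hy)) with (t := t) as [E _].
  + rewrite !Rplus_0_l. lra.
  + rewrite !Rplus_0_l. lra.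
  + unfold Rminus. lra.
Qed.

Lemma even_bounded (u du : R -> R) :
  hill q u du -> du 0 = 0 -> bounded_on_R u.
Proof.
intros Hu Hdu0.
destruct (Req_dec (u 0) 0) as [H0|H0].
{ exists 0. intros t. destruct (hill_zero q u du 0 Hcont Hu H0 Hdu0 t) as [-> _].
  rewrite Rabs_R0. lra. }
(* Dividing by [u 0] normalizes the initial value to [1], whatever the sign of [u 0]. *)
assert (Hk : -1 < / u 0 * u (2 * a) < 1).
{ destruct (even_multiplier q Q1 Q2 C dC S dS a Ha Hqa Hq1 Hq2 HC HS _ _
              (hill_lin_comb q _ _ _ _ (/ u 0) 0 Hu Hu)) as [H1 H2].
  - rewrite Rinv_l by exact H0. lra.
  - rewrite Hdu0. ring.
  - rewrite Rinv_l in H1, H2 by exact H0. lra. }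
(* By uniqueness [u] is even and [du] odd, which gives the values at [- (2 * a)]. *)
destruct (hill_unique q _ _ _ _ 0 Hcont Hu (hill_reflect_origin u du Hu))
  with (t := 2 * a) as [E E'].
{ now rewrite Rminus_0_r. }
{ rewrite Rminus_0_r. lra. }
replace (0 - 2 * a) with (- (2 * a)) in E, E' by ring.
apply (hill_bounded_of_multiplier u du _ Hu Hk).
- rewrite <- E. field. exact H0.
- rewrite E', Hdu0. ring.
Qed.

Lemma odd_bounded (v dv : R -> R) :
  hill q v dv -> v 0 = 0 -> bounded_on_R v.
Proof.
intros Hv Hv0.
destruct (Req_dec (dv 0) 0) as [H0|H0].
{ exists 0. intros t. destruct (hill_zero q v dv 0 Hcont Hv Hv0 H0 t) as [-> _].
  rewrite Rabs_R0. lra. }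
assert (Hk : -1 < / dv 0 * dv (2 * a) < 1).
{ destruct (odd_multiplier q Q1 Q2 C dC S dS a Ha Hqa Hq1 Hq2 HC HS _ _
              (hill_lin_comb q _ _ _ _ (/ dv 0) 0 Hv Hv)) as [H1 H2].
  - rewrite Hv0. ring.
  - rewrite Rinv_l by exact H0. lra.
  - rewrite Rinv_l in H1, H2 by exact H0. lra. }
pose proof (hill_reflect_origin v dv Hv) as Hr.
(* By uniqueness [v] is odd and [dv] even. *)
destruct (hill_unique q _ _ _ _ 0 Hcont Hv (hill_lin_comb q _ _ _ _ (-1) 0 Hr Hr))
  with (t := 2 * a) as [E E'].
{ rewrite Rminus_0_r, Hv0. ring. }
{ rewrite Rminus_0_r. ring. }
replace (0 - 2 * a) with (- (2 * a)) in E, E' by ring.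
apply (hill_bounded_of_multiplier v dv _ Hv Hk).
- rewrite E, Hv0. ring.
- replace (dv (- (2 * a))) with (dv (2 * a)) by lra. field. exact H0.
Qed.

(** Since [q] is even, the even and odd parts of [y] are again solutions. *)
Lemma hill_bounded (y dy : R -> R) : hill q y dy -> bounded_on_R y.
Proof.
intros Hy. pose proof (hill_reflect_origin y dy Hy) as Hr.
destruct (even_bounded _ _ (hill_lin_comb q _ _ _ _ (1 / 2) (1 / 2) Hy Hr))
  as [M1 H1].
{ rewrite Rminus_0_r. ring. }
destruct (odd_bounded _ _ (hill_lin_comb q _ _ _ _ (1 / 2) (- (1 / 2)) Hy Hr))
  as [M2 H2].
{ rewrite Rminus_0_r. ring. }
exists (M1 + M2). intros t. specialize (H1 t). specialize (H2 t).
apply Rabs_le_between in H1. apply Rabs_le_between in H2.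
apply Rabs_le. lra.
Qed.

End Boundedness.

(** * The Duffing equation of the mode: uniqueness, quarter period and symmetries *)

Definition duffing (M : R) (x dx : R -> R) : Prop :=
  (forall t, is_derive x t (dx t)) /\
  (forall t, is_derive dx t (- (M * (x t + x t ^ 3)))).

Lemma duffing_opp (M : R) (x dx : R -> R) :
  duffing M x dx -> duffing M (fun t => - x t) (fun t => - dx t).
Proof.
intros [Hx Hdx]. split; intros t.
- apply (is_derive_opp x), Hx.
- replace (- (M * (- x t + (- x t) ^ 3))) with (- - (M * (x t + x t ^ 3))) by ring.
  apply (is_derive_opp dx), Hdx.
Qed.

Lemma duffing_reflect (M : R) (x dx : R -> R) (c : R) :
  duffing M x dx -> duffing M (fun t => x (c - t)) (fun t => - dx (c - t)).
Proof.
intros [Hx Hdx]. split; intros t.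
- now apply is_derive_reflect.
- rewrite <- (Ropp_involutive (M * _)).
  apply (is_derive_opp (fun s => dx (c - s))).
  now apply (is_derive_reflect dx (fun s => - (M * (x s + x s ^ 3)))).
Qed.

(* The difference of two solutions solves a linear equation. *)
Lemma duffing_unique (M : R) (x dx y dy : R -> R) (t0 : R) :
  duffing M x dx -> duffing M y dy -> x t0 = y t0 -> dx t0 = dy t0 ->
  forall t, x t = y t.
Proof.
intros [Hx Hdx] [Hy Hdy] H0 H0' t.
(* The potential comes from factoring [x - y] out of [(x + x ^ 3) - (y + y ^ 3)]. *)
destruct (hill_zero (fun t => M * (1 + x t ^ 2 + x t * y t + y t ^ 2))
  (fun t => 1 * x t + -1 * y t) (fun t => 1 * dx t + -1 * dy t) t0) with (t := t)
  as [H _]; try lra.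
- apply (is_derive_continuity _ (fun t =>
    M * (2 * x t * dx t + (dx t * y t + x t * dy t) + 2 * y t * dy t))).
  intros s. auto_derive.
  + repeat match goal with |- _ /\ _ => split end; try easy;
      eexists; first [apply Hx | apply Hy].
  + rewrite (is_derive_unique (fun x0 => x x0) _ _ (Hx _)),
      (is_derive_unique (fun x0 => y x0) _ _ (Hy _)). ring.
- split; intros s.
  + now apply is_derive_lin_comb.
  + replace (- (M * (1 + x s ^ 2 + x s * y s + y s ^ 2)) * (1 * x s + -1 * y s))
      with (1 * - (M * (x s + x s ^ 3)) + -1 * - (M * (y s + y s ^ 3))) by ring.
    now apply (is_derive_lin_comb dx (fun s => - (M * (x s + x s ^ 3)))
                 dy (fun s => - (M * (y s + y s ^ 3)))).
Qed.

Section QuarterPeriod.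

Variables (M : R) (x dx : R -> R).
Hypothesis HM : 0 < M.
Hypothesis Hmode : duffing M x dx.
Hypothesis Hx0 : 0 < x 0.
Hypothesis Hdx0 : dx 0 = 0.

Lemma velocity_decreasing (s t : R) :
  s < t -> (forall r, s < r < t -> 0 < x r) -> dx t < dx s.
Proof.
intros Hst Hpos.
assert (H : - dx s < - dx t); [|lra].
apply (lt_of_derive_pos (fun r => - dx r) (fun r => M * (x r + x r ^ 3)) s t Hst).
- intros r. rewrite <- (Ropp_involutive (M * _)).
  apply (is_derive_opp dx), (proj2 Hmode).
- intros r Hr. specialize (Hpos r Hr). apply Rmult_lt_0_compat; [exact HM|].
  pose proof (pow_lt (x r) 3 Hpos). lra.
Qed.

(** If [x] stayed positive, its velocity would decrease forever from [0], so after time [1] the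
    graph would lie below a tangent of negative slope. *)
Lemma quarter_period :
  exists a, 0 < a /\ x a = 0 /\ forall t, 0 <= t < a -> 0 < x t.
Proof.
destruct (pos_right_of_pos x dx (proj1 Hmode) Hx0) as [e [He Hepos]].
assert (Hex : exists b, 0 < b /\ x b <= 0).
{ apply NNPP. intros Hno.
  assert (Hpos : forall t, 0 < t -> 0 < x t).
  { intros t Ht. apply Rnot_le_lt. intros H. apply Hno. now exists t. }
  assert (Hd : forall s t, 0 <= s -> s < t -> dx t < dx s).
  { intros s t Hs Hst. apply velocity_decreasing; [exact Hst|].
    intros r Hr. apply Hpos. lra. }
  assert (Hd1 : dx 1 < 0) by (rewrite <- Hdx0; apply Hd; lra).
  assert (Hx1 : 0 < x 1) by (apply Hpos; lra).
  assert (Hr : 0 < x 1 / - dx 1) by (apply Rdiv_lt_0_compat; lra).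
  (* [T] is the zero of the tangent to [x] at [1]. *)
  set (T := 1 + x 1 / - dx 1).
  assert (HT : 0 < x T) by (apply Hpos; unfold T; lra).
  assert (Hlt : - x 1 + dx 1 * 1 < - x T + dx 1 * T).
  { apply (lt_of_derive_pos (fun t => - x t + dx 1 * t) (fun t => - dx t + dx 1)).
    - unfold T. lra.
    - intros t. auto_derive; [eexists; apply (proj1 Hmode)|].
      rewrite (is_derive_unique (fun x0 => x x0) _ _ (proj1 Hmode _)). ring.
    - intros t Ht. specialize (Hd 1 t). lra. }
  replace (dx 1 * T) with (dx 1 - x 1) in Hlt by (unfold T; field; lra). lra. }
destruct Hex as [b [Hb Hxb]].
destruct (first_zero x e b) as [a [Ha [Hxa Hbelow]]]; try assumption.
{ apply (is_derive_continuity x dx), Hmode. }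
exists a. repeat split; [lra | exact Hxa |].
intros t Ht. destruct (Req_dec t 0) as [->|]; [exact Hx0 | apply Hbelow; lra].
Qed.

Lemma duffing_even (t : R) : x (0 - t) = x t.
Proof.
symmetry.
apply (duffing_unique M x dx (fun s => x (0 - s)) (fun s => - dx (0 - s)) 0);
  [exact Hmode | now apply duffing_reflect | now rewrite Rminus_0_r |].
rewrite Rminus_0_r. lra.
Qed.

(** The nonlinearity is odd, so [- x (2 * a - s)] is a solution too; it shares value [0] and
    velocity [dx a] with [x] at [a]. *)
Lemma duffing_quarter_reflect (a t : R) : x a = 0 -> x (t + a) = - x (a - t).
Proof.
intros Hxa.
replace (a - t) with (2 * a - (t + a)) by ring.
apply (duffing_unique M x dx (fun s => - x (2 * a - s)) (fun s => - - dx (2 * a - s)) a).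
- exact Hmode.
- apply (duffing_opp M (fun s => x (2 * a - s)) (fun s => - dx (2 * a - s))).
  now apply duffing_reflect.
- replace (2 * a - a) with a by ring. lra.
- replace (2 * a - a) with a by ring. lra.
Qed.

Lemma duffing_cos_like (a : R) :
  x a = 0 -> (forall t, 0 <= t < a -> 0 < x t) ->
  cos_like (fun t => M * (1 + x t ^ 2)) x dx a.
Proof.
intros Hxa Hpos. split; [|repeat split; assumption].
split; intros t; [apply Hmode|].
replace (- (M * (1 + x t ^ 2)) * x t) with (- (M * (x t + x t ^ 3))) by ring.
apply Hmode.
Qed.

(** Differentiating the Duffing equation gives its linearization, solved by the velocity; the minus
    sign makes the solution positive on [(0, a]]. *)
Lemma duffing_sin_like (a : R) :
  x a = 0 -> (forall t, 0 <= t < a -> 0 < x t) ->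
  sin_like (fun t => M * (1 + 3 * x t ^ 2)) (fun t => - dx t)
    (fun t => M * (x t + x t ^ 3)) a.
Proof.
destruct Hmode as [Hx Hdx].
intros Hxa Hpos. split; [split|split; [|split]].
- intros t. rewrite <- (Ropp_involutive (M * _)). apply (is_derive_opp dx), Hdx.
- intros t. auto_derive; [split; [|split; [|easy]]; eexists; apply Hx|].
  rewrite (is_derive_unique (fun x0 => x x0) _ _ (Hx _)). ring.
- rewrite Hdx0. ring.
- rewrite Hxa. ring.
- intros t Ht. assert (dx t < dx 0); [|lra].
  apply velocity_decreasing; [lra|]. intros r Hr. apply Hpos. lra.
Qed.

Lemma duffing_hill_bounded (A B : R) (y dy : R -> R) :
  0 < A < M -> 0 < B < M ->
  hill (fun t => A + B * x t ^ 2) y dy -> bounded_on_R y.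
Proof.
intros HA HB Hy.
destruct quarter_period as [a [Ha [Hxa Hpos]]].
assert (Hq : forall t, 0 < A + B * x t ^ 2 < M * (1 + x t ^ 2)).
{ intros t. pose proof (pow2_ge_0 (x t)). split; nra. }
apply (hill_bounded (fun t => A + B * x t ^ 2) (fun t => M * (1 + x t ^ 2))
         (fun t => M * (1 + 3 * x t ^ 2)) x dx (fun t => - dx t)
         (fun t => M * (x t + x t ^ 3)) a) with (dy := dy).
- exact Ha.
- apply (is_derive_continuity _ (fun t => B * (2 * x t * dx t))). intros t. auto_derive.
  + repeat split; eexists; apply (proj1 Hmode).
  + rewrite (is_derive_unique (fun x0 => x x0) _ _ (proj1 Hmode _)). ring.
- intros t. now rewrite duffing_even.
(* [x] is odd about [a], hence its square is symmetric about [a]. *)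
- intros t. rewrite (duffing_quarter_reflect a t Hxa). ring.
- exact Hq.
- intros t. specialize (Hq t). pose proof (pow2_ge_0 (x t)). split; nra.
- now apply duffing_cos_like.
- now apply duffing_sin_like.
- exact Hy.
Qed.

End QuarterPeriod.

Theorem theorem9 (m n : nat) (hn : (1 <= n)%nat) (hmn : (n < m)%nat)
  (delta : R) (hdelta : delta <> 0)
  (Theta : R -> R) (hTheta : is_nonlinear_mode m delta Theta) :
  linearly_stable m n Theta.
Proof.
intros xi [Hxi Hxieq].
destruct hTheta as [HT [HTeq [HT0 HdT0]]].
set (M := INR m ^ 4).
assert (Hn : 1 <= INR n) by (apply (le_INR 1), hn).
assert (Hmn : INR n < INR m) by (apply lt_INR, hmn).
(* Here [n < m] enters: it puts both coefficients, [n ^ 4] and [m ^ 2 * n ^ 2], below [m ^ 4]. *)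
assert (Hsq : 0 < INR n ^ 2 < INR m ^ 2) by nra.
assert (HA : 0 < INR n ^ 4 < M).
{ unfold M. replace (INR n ^ 4) with (INR n ^ 2 * INR n ^ 2) by ring.
  replace (INR m ^ 4) with (INR m ^ 2 * INR m ^ 2) by ring. nra. }
assert (HB : 0 < INR m ^ 2 * INR n ^ 2 < M).
{ unfold M. replace (INR m ^ 4) with (INR m ^ 2 * INR m ^ 2) by ring. nra. }
assert (Hmode : duffing M Theta (Derive Theta)).
{ split; intros t.
  - apply Derive_correct, (HT t).
  - replace (- (M * (Theta t + Theta t ^ 3))) with (Derive_n Theta 2 t).
    + apply (Derive_correct (Derive Theta)), (HT t).
    + specialize (HTeq t). fold M in HTeq. lra. }
assert (Hhill : hill (fun t => INR n ^ 4 + INR m ^ 2 * INR n ^ 2 * Theta t ^ 2)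
                  xi (Derive xi)).
{ split; intros t.
  - apply Derive_correct, (Hxi t).
  - replace (- (INR n ^ 4 + INR m ^ 2 * INR n ^ 2 * Theta t ^ 2) * xi t)
      with (Derive_n xi 2 t).
    + apply (Derive_correct (Derive xi)), (Hxi t).
    + specialize (Hxieq t). lra. }
destruct (Rdichotomy _ _ hdelta) as [Hneg|Hpos].
(* For negative [delta], [- Theta] has positive initial value and gives the same Hill potential. *)
- apply (duffing_hill_bounded M (fun t => - Theta t) (fun t => - Derive Theta t))
    with (A := INR n ^ 4) (B := INR m ^ 2 * INR n ^ 2) (dy := Derive xi);
    try assumption; try lra.
  + now apply duffing_opp.
  + revert Hhill. apply hill_ext. intros t. ring.
- apply (duffing_hill_bounded M Theta (Derive Theta))
    with (A := INR n ^ 4) (B := INR m ^ 2 * INR n ^ 2) (dy := Derive xi);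
    try assumption; lra.
Qed.
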